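(* Let $G$ be a finite group, $N$ a normal subgroup of $G$, and $H$ a subgroup of $G$ which contains $N$. Then the following hold: (a) if $H$ is a perfect code of $G$, then $H/N$ is a perfect code of $G/N$; (b) if $N$ and $H/N$ are perfect codes of $G$ and $G/N$, respectively, then $H$ is a perfect code of $G$.
   Context: For a finite group $G$ with identity $1$ and a subset $S\subseteq G\setminus\{1\}$ with $S^{-1}=S$ (possibly $S=\emptyset$), the Cayley graph $\mathrm{Cay}(G,S)$ has vertex set $G$, with $x,y$ adjacent if and only if $yx^{-1}\in S$. A perfect code in a graph $\Gamma$ with vertex set $V$ is a subset $C\subseteq V$ such that no two vertices of $C$ are adjacent and every vertex in $V\setminus C$ is adjacent to exactly one vertex in $C$. A subset (in particular a subgroup) $C$ of $G$ is called a perfect code of $G$ if there exists such an $S$ for which $C$ is a perfect code in $\mathrm{Cay}(G,S)$. *)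

(* Defs.v *)
From mathcomp Require Import all_boot all_fingroup.

Set Implicit Arguments.
Unset Strict Implicit.
Unset Printing Implicit Defensive.

Local Open Scope group_scope.

(* A graph is a vertex set V in an ambient finite type together with an
   adjacency relation, of which only the restriction to V matters. *)
Definition graph_perfect_code (T : finType) (V : {set T}) (adj : rel T)
    (C : {set T}) : Prop :=
  [/\ C \subset V,
      {in C &, forall x y, ~~ adj x y}
    & {in V :\: C, forall x, #|[set y in C | adj x y]| = 1%N}].

(* S^-1 is the pointwise inverse of the set S. *)
Definition connection_set (gT : finGroupType) (G S : {set gT}) : Prop :=
  S \subset G^# /\ S^-1 = S.

Definition cayley_adj (gT : finGroupType) (S : {set gT}) : rel gT :=
  fun x y => y * x^-1 \in S.

Definition perfect_code (gT : finGroupType) (G : {group gT}) (C : {set gT}) :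
    Prop :=
  exists2 S : {set gT},
    connection_set G S & graph_perfect_code G (cayley_adj S) C.

(* Main.v *)
Require Import Defs.
From mathcomp Require Import all_boot all_fingroup.

(** A subgroup [H] of [G] is a perfect code exactly when it has a left
    transversal in [G] closed under inversion ([perfect_codeP]): if [H] is a
    perfect code in the Cayley graph of [S], then [1 |: S] is one, because the
    neighbours in [H] of a vertex [x] outside [H] correspond to the elements of
    [S] in the coset [x *: H].

    Since [N \subset H], the cosets of [H] in [G] are the full preimages of the
    cosets of [H / N] in [G / N] ([cosetpre_lcoset]).  For (a), therefore, the
    image in [G / N] of a symmetric transversal of [H] is a symmetric
    transversal of [H / N].  For (b), let [A] and [B] be symmetric transversals
    of [N] in [G] and of [H / N] in [G / N].  As [A] meets every coset of [N]
    exactly once, the part of [A] lying above [B] lifts [B] bijectively to [G];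
    this lift is closed under inversion because [A] and [B] are, and it is a
    transversal of [H]. *)

Set Implicit Arguments.
Unset Strict Implicit.
Unset Printing Implicit Defensive.

Local Open Scope group_scope.

Definition symmetric_transversal (gT : finGroupType) (G H T : {set gT}) :=
  [/\ T \subset G, T^-1 = T & {in G, forall x, #|T :&: x *: H| = 1%N}].

(** The bijection is [y |-> x * y^-1]; the symmetry of [S] is what turns the
    adjacency condition [y * x^-1 \in S] into [x * y^-1 \in S]. *)
Lemma card_cayley_neighbours (gT : finGroupType) (H : {group gT})
    (S : {set gT}) (x : gT) :
  S^-1 = S -> #|[set y in H | cayley_adj S x y]| = #|S :&: x *: H|.
Proof.
move=> symS; have inj_f: injective (fun y => x * y^-1).
  by move=> y z /mulgI/invg_inj.
rewrite -(card_imset _ inj_f); apply: eq_card => z.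
apply/imsetP/setIP => [[y] | [Sz /lcosetP[h Hh def_z]]].
  rewrite inE => /andP[Hy Sy] ->; rewrite mem_lcoset mulKg groupV; split=> //.
  by rewrite -symS inE invMg invgK.
exists h^-1; last by rewrite invgK.
by rewrite inE groupV Hh /cayley_adj -invMg -def_z -mem_invg symS.
Qed.

(** In the converse direction the representative of the coset [H] itself need
    not be [1], so the connection set is obtained from [T] by removing all of
    [H] rather than the identity alone. *)
Lemma perfect_codeP (gT : finGroupType) (G H : {group gT}) :
  H \subset G ->
  perfect_code G H <-> exists T : {set gT}, symmetric_transversal G H T.
Proof.
move=> sHG; split=> [[S [sSG symS] [_ indepH domH]] | [T [sTG symT cardT]]].
  have notHS s : s \in S -> s \notin H.
    move=> Ss; apply/negP => Hs; have /negP[] := indepH _ _ (group1 H) Hs.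
    by rewrite /cayley_adj invg1 mulg1.
  exists (1 |: S); split=> [||x Gx].
  - by rewrite subUset sub1G (subset_trans sSG) ?subD1set.
  - by apply/setP=> y; rewrite !inE -mem_invg symS eq_invg1.
  have [Hx | notHx] := boolP (x \in H).
    rewrite lcoset_id //; apply/eqP/cards1P; exists 1; apply/setP=> y.
    rewrite !inE; case: eqP => [-> | _] /=; first exact: group1.
    by apply/andP=> -[/notHS/negP].
  rewrite setIUl (_ : 1%g :&: x *: H = set0); last first.
    apply/setP=> y; rewrite !inE; case: eqP => // ->.
    by rewrite mem_lcoset mulg1 groupV (negPf notHx).
  by rewrite set0U -card_cayley_neighbours // domH // inE notHx.
have symS: (T :\: H)^-1 = T :\: H.
  by apply/setP=> y; rewrite !inE groupV -mem_invg symT.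
exists (T :\: H); first split=> //.
  apply/subsetP=> y /setDP[Ty notHy]; rewrite !inE (subsetP sTG) // andbT.
  by apply: contraNneq notHy => ->; apply: group1.
split=> // [x y Hx Hy | x /setDP[Gx notHx]].
  by rewrite /cayley_adj inE groupMr ?groupV // Hy.
rewrite card_cayley_neighbours // -(cardT x Gx); apply: eq_card => y.
rewrite !inE; have [Hy | //] := boolP (y \in H).
by rewrite mem_lcoset groupMr // groupV (negPf notHx) !andbF.
Qed.

Lemma cosetpre_lcoset (gT : finGroupType) (N H : {group gT}) (x : gT) :
  N <| H -> x \in 'N(N) -> coset N @*^-1 (coset N x *: (H / N)) = x *: H.
Proof.
move=> nsNH Nx; have [sNH nNH] := andP nsNH.
rewrite -quotient_set1 // -quotientMl ?sub1set //.
rewrite quotientK ?mul_subG ?sub1set // mulgA -(@normC _ [set x]) ?sub1set //.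
by rewrite -mulgA mulSGid.
Qed.

Lemma quotient_symmetric_transversal (gT : finGroupType)
    (G N H : {group gT}) (T : {set gT}) :
  N <| G -> N \subset H -> H \subset G -> symmetric_transversal G H T ->
  symmetric_transversal (G / N) (H / N) (T / N).
Proof.
move=> nsNG sNH sHG [sTG symT cardT].
have nsNH := normalS sNH sHG nsNG; have nNG := normal_norm nsNG.
split=> [||_ /morphimP[x Nx Gx ->]]; first exact: quotientS.
  by rewrite -quotientV symT.
rewrite -morphim_setIpre cosetpre_lcoset //.
have /eqP/cards1P[t def_t] := cardT x Gx.
have /setIP[Tt _]: t \in T :&: x *: H by rewrite def_t set11.
have Nt: t \in 'N(N) by rewrite (subsetP nNG) ?(subsetP sTG).
by rewrite def_t -/(quotient _ _) quotient_set1 // cards1.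
Qed.

Lemma lift_symmetric_transversal (gT : finGroupType) (G N H : {group gT})
    (A : {set gT}) (B : {set coset_of N}) :
  N <| G -> N \subset H -> H \subset G ->
  symmetric_transversal G N A -> symmetric_transversal (G / N) (H / N) B ->
  symmetric_transversal G H (A :&: coset N @*^-1 B).
Proof.
move=> nsNG sNH sHG [sAG symA cardA] [sBG symB cardB].
have nsNH := normalS sNH sHG nsNG; have nNG := normal_norm nsNG.
split=> [||x Gx]; first by rewrite subIset ?sAG.
  by rewrite invIg symA -morphpreV symB.
have Nx := subsetP nNG x Gx.
rewrite -(cosetpre_lcoset nsNH Nx) -setIA -morphpreI.
have /eqP/cards1P[b def_b] := cardB _ (mem_quotient N Gx).
have /setIP[Bb _]: b \in B :&: coset N x *: (H / N) by rewrite def_b set11.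
have /morphimP[g Ng Gg def_g] := subsetP sBG b Bb.
(* Above the coset of [H] through [x], only the coset [b] of [N] remains. *)
by rewrite def_b def_g cosetpre_set1 // norm_rlcoset // cardA.
Qed.

Theorem theorem3p7 (gT : finGroupType) (G N H : {group gT})
    (nNG : (N <| G)%g) (sNH : N \subset H) (sHG : H \subset G) :
  (perfect_code G H -> perfect_code (G / N)%G (H / N)%g) /\
  (perfect_code G N -> perfect_code (G / N)%G (H / N)%g -> perfect_code G H).
Proof.
have sHGq: (H / N)%G \subset (G / N)%G by exact: quotientS.
split=> [/(perfect_codeP sHG)[T trT] | ].
  apply/(perfect_codeP sHGq); exists (T / N).
  exact: quotient_symmetric_transversal.
move=> /(perfect_codeP (normal_sub nNG))[A trA] /(perfect_codeP sHGq)[B trB].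
apply/(perfect_codeP sHG); exists (A :&: coset N @*^-1 B).
exact: lift_symmetric_transversal.
Qed.
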